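(* For every integer $n\ge 5$, the graph $U_n$ is uniformly most reliable with respect to node cop-win reliability among all unicyclic graphs of order $n$; that is, $\operatorname{NCRel}(G,p)\le \operatorname{NCRel}(U_n,p)$ for every $p\in[0,1]$ and every unicyclic graph $G$ of order $n$.
   Context: All graphs are finite, simple and undirected. A unicyclic graph is a connected graph $G$ with $|V(G)|=|E(G)|$. The graph $U_n$ is $(K_2\cup\overline{K_{n-3}})\vee K_1$, i.e. a vertex $c$ adjacent to all other $n-1$ vertices, where among the other vertices there is exactly one edge $ab$ (so $U_n$ is a triangle $cab$ with $n-3$ pendant leaves attached at $c$). A graph is cop-win if, in the game of Cops and Robber with one cop (the cop chooses a starting vertex, then the robber chooses one, then they alternately move to an adjacent vertex or stay put, the cop winning if he ever occupies the robber's vertex), the cop can guarantee capture. For a graph $G$ of order $n$, let $W_i(G)$ be the number of vertex subsets of size $i$ inducing a cop-win subgraph of $G$; the node cop-win reliability is $\operatorname{NCRel}(G,p)=\sum_{i=1}^n W_i(G)(1-p)^{n-i}p^i$, the probability that the set of operational vertices induces a cop-win graph when each vertex is operational independently with probability $p$. *)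

(* Defs.v *)
From HB Require Import structures.
From mathcomp Require Import all_boot all_order all_algebra.
From mathcomp Require Import boolp reals.

Set Implicit Arguments.
Unset Strict Implicit.
Unset Printing Implicit Defensive.

Import Order.TTheory GRing.Theory Num.Theory.

Local Open Scope ring_scope.

Record sgraph (V : finType) := SGraph {
  adj :> rel V;
  adj_sym : symmetric adj;
  adj_irrefl : irreflexive adj }.

Definition edges (V : finType) (G : sgraph V) : {set {set V}} :=
  [set [set x.1; x.2] | x : V * V & G x.1 x.2].

Definition connected (V : finType) (G : sgraph V) : Prop :=
  (0 < #|V|)%N /\ forall u v : V, connect G u v.

Definition unicyclic (V : finType) (G : sgraph V) : Prop :=
  connected G /\ #|V| = #|edges G|.

Section Induced.
Variables (V : finType) (G : sgraph V) (S : {set V}).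

Definition induced_adj : rel {x : V | x \in S} :=
  [rel u v | G (val u) (val v)].

Lemma induced_adj_sym : symmetric induced_adj.
Proof. by move=> u v; exact: adj_sym. Qed.

Lemma induced_adj_irrefl : irreflexive induced_adj.
Proof. by move=> u; exact: adj_irrefl. Qed.

Definition induced : sgraph {x : V | x \in S} :=
  SGraph induced_adj_sym induced_adj_irrefl.

End Induced.

Definition move (V : finType) (G : sgraph V) (u v : V) : bool :=
  (u == v) || G u v.

(* A cop strategy sigma maps the sequence of robber positions seen so far to
   the next position of the cop: sigma [::] is his starting vertex, and
   against the robber's play r his t-th position is
   sigma [:: r 0; ...; r t.-1].  The order of play is therefore
   c 0, r 0, c 1, r 1, ..., and the robber is caught either by moving onto
   (or starting at) the cop's vertex, c t = r t, or by a move of the cop,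
   c t.+1 = r t.  Since a strategy yields a starting vertex, the graph
   without vertices is not cop-win. *)
Definition cop_win (V : finType) (G : sgraph V) : Prop :=
  exists sigma : seq V -> V,
    forall r : nat -> V, (forall t, move G (r t) (r t.+1)) ->
    let c t := sigma (mkseq r t) in
    (forall t, move G (c t) (c t.+1)) /\
    (exists t, c t = r t \/ c t.+1 = r t).

Definition W (V : finType) (G : sgraph V) (i : nat) : nat :=
  #|[set S : {set V} | (#|S| == i) && `[< cop_win (induced G S) >]]|.

Definition NCRel (R : realType) (V : finType) (G : sgraph V) (p : R) : R :=
  \sum_(1 <= i < #|V|.+1) (W G i)%:R * (1 - p) ^+ (#|V| - i) * p ^+ i.

Section UGraph.
Variable n : nat.

(* The vertices c, a, b are 0, 1, 2; meaningful for 3 <= n. *)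
Definition U_adj : rel 'I_n := fun u v =>
  (u != v) &&
  [|| val u == 0%N, val v == 0%N
    | (val u \in [:: 1; 2]%N) && (val v \in [:: 1; 2]%N)].

Lemma U_adj_sym : symmetric U_adj.
Proof.
by move=> u v; rewrite /U_adj eq_sym orbCA [X in [|| _, _ | X]]andbC.
Qed.

Lemma U_adj_irrefl : irreflexive U_adj.
Proof. by move=> u; rewrite /U_adj eqxx. Qed.

Definition U_graph : sgraph 'I_n := SGraph U_adj_sym U_adj_irrefl.

End UGraph.

(* Main.v *)
(* For i >= 3 the cop-win sets of U_n of size i are exactly those containing the
   centre, so W_i(U_n) = C(n-1, i-1), while W_1 and W_2 count vertices and edges.
   If v is a leaf of G with neighbour u, a cop-win set of size i >= 2 either avoids
   v or contains both u and v, whence W_i(G) <= W_i(G - v) + C(n-2, i-2): the bound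
   C(n-1, i-1) is inherited from G - v to G.  A connected graph with at most as
   many edges as vertices and no leaf is a cycle; a cycle of length at least 4 is
   not cop-win, and its only W_i above the bound, at
   i = length - 1, exceeds it by 1; attaching a leaf v absorbs this, because one
   of the C(n-2, i-2) sets containing u and v, the complement of the two cycle
   neighbours of u, is disconnected.  So only G = C_n is left, where W_i <= n for i < n and
   W_n = 0, and there
     NCRel(U_n) - NCRel(G) >= p^(n-2) ((1 - p)^2 - (1 - p) p + p^2) >= 0. *)
Require Import Defs.
From HB Require Import structures.
From mathcomp Require Import all_boot all_order all_algebra.
From mathcomp Require Import boolp reals.
From mathcomp Require Import zify ring lra.

Set Implicit Arguments.
Unset Strict Implicit.
Unset Printing Implicit Defensive.

Import Order.TTheory GRing.Theory Num.Theory.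

(** * Criteria for losing and winning the game *)

(** [safe] is an invariant of the positions after the robber's move: he can start in it, and he can
    restore it after any legal move of the cop. Playing this way against a given [sigma], he is
    never caught. *)
Lemma evasion_not_cop_win (V : finType) (G : sgraph V) (safe : rel V) :
  (forall c, exists r, safe c r) ->
  (forall c r, safe c r -> c != r) ->
  (forall c r c', safe c r -> move G c c' ->
     c' != r /\ exists2 r', move G r r' & safe c' r') ->
  ~ cop_win G.
Proof.
move=> start neq step [sigma win].
have [d0 _] := start (sigma [::]).
(* The robber stays put when he has no safe move: his play must be legal before
   anything is known about the cop's moves. *)
pose next h := if h is [::] then odflt d0 [pick r | safe (sigma [::]) r]
  else odflt (last d0 h) [pick r | move G (last d0 h) r && safe (sigma h) r].
pose fix hist t := if t is t'.+1 then rcons (hist t') (next (hist t')) else [::].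
pose r t := next (hist t).
have histE t : hist t = mkseq r t by elim: t => [|t IHt] //; rewrite mkseqS -IHt.
have lastE t : last d0 (hist t.+1) = r t by rewrite /= last_rcons.
have rS t : r t.+1 =
    odflt (r t) [pick x | move G (r t) x && safe (sigma (mkseq r t.+1)) x].
  rewrite -histE -[r t]lastE [LHS]/r /next; case E: (hist t.+1) => [|a l] //.
  by move: E => /= E; have := congr1 size E; rewrite size_rcons.
have legal t : move G (r t) (r t.+1).
  by rewrite rS; case: pickP => [x /andP[] //|_]; rewrite /= /move eqxx.
have [cmove [s caught]] := win r legal.
have inv k : safe (sigma (mkseq r k)) (r k).
  elim: k => [|k IHk].
    rewrite /= /r /=; case: pickP => [x //|none].
    by have [x] := start (sigma [::]); rewrite none.
  have [_ [x mx sx]] := step _ _ _ IHk (cmove k).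
  rewrite rS; case: pickP => [y /andP[] //|/(_ x)].
  by rewrite mx sx.
case: caught => e.
  by have := neq _ _ (inv s); rewrite e eqxx.
by have [] := step _ _ _ (inv s) (cmove s); rewrite e eqxx.
Qed.

(** The cop starts at [d] and then always steps to the robber's last known position, which catches
    him at once. His later moves are legal because they copy the robber's. *)
Lemma dominating_cop_win (V : finType) (G : sgraph V) (d : V) :
  (forall x, move G d x) -> cop_win G.
Proof.
move=> dom; exists (last d) => r legal c.
have cS t : c t.+1 = r t by rewrite /c mkseqS last_rcons.
split; last by exists 0; right; exact: cS.
by case=> [|t]; rewrite !cS; [exact: dom | exact: legal].
Qed.

(** * Darts, degrees and connected vertex subsets *)

Section Sets.
Variables (V : finType) (G : sgraph V).
Implicit Types (A B S T X : {set V}) (u v x y : V).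

Definition connected_set S : Prop :=
  S != set0 /\ forall X, X \proper S -> X != set0 ->
    exists x y, [/\ x \in X, y \in S :\: X & G x y].

(** Ordered pairs: [darts A A] holds each edge inside [A] in both orientations. *)
Definition darts A B : {set V * V} :=
  [set d | [&& d.1 \in A, d.2 \in B & G d.1 d.2]].

Definition degree A v := #|[set u in A | G v u]|.

(** The sets counted by [W], restricted to subsets of [A]: deleting a vertex then changes [A] and
    not the vertex type. *)
Definition cop_sets A i : {set {set V}} :=
  [set S : {set V} | [&& S \subset A, #|S| == i & `[< cop_win (induced G S) >]]].

Lemma degreeE A v : degree A v = \sum_(u in A) G v u.
Proof.
rewrite /degree -sum1_card big_mkcond [RHS]big_mkcond /=.
by apply: eq_bigr => u _; rewrite inE; case: (u \in A); case: (G v u).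
Qed.

Lemma card_darts A B : #|darts A B| = \sum_(v in A) degree B v.
Proof.
rewrite -sum1_card big_mkcond /=.
under [RHS]eq_bigr => v _ do rewrite degreeE.
rewrite pair_big_dep /= [RHS]big_mkcond /=.
apply: eq_bigr => -[x y] _; rewrite inE /=.
by case: (x \in A); case: (y \in B); case: (G x y).
Qed.

Lemma degreeD1 A v w : v \in A -> degree A w = G w v + degree (A :\ v) w.
Proof.
by move=> vA; rewrite !degreeE (bigD1 v) //=; congr addn; apply: eq_bigl => u; rewrite !inE andbC.
Qed.

Lemma card_dartsD1 A v : v \in A ->
  #|darts A A| = #|darts (A :\ v) (A :\ v)| + (degree A v).*2.
Proof.
move=> vA; rewrite !card_darts (big_setD1 v) //=.
have -> : \sum_(w in A :\ v) degree A w =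
    \sum_(w in A :\ v) G w v + \sum_(w in A :\ v) degree (A :\ v) w.
  by rewrite -big_split; apply: eq_bigr => w _; exact: degreeD1.
have -> : \sum_(w in A :\ v) G w v = degree A v.
  rewrite (degreeD1 _ vA) adj_irrefl add0n degreeE.
  by apply: eq_bigr => w _; rewrite adj_sym.
by rewrite -addnn; lia.
Qed.

(** Handshake lemma: deleting a vertex removes both orientations of each of its edges. *)
Lemma odd_card_darts S : ~~ odd #|darts S S|.
Proof.
have [k] := ubnP #|S|; elim: k S => // k IHk S; rewrite ltnS => leSk.
have [->|/set0Pn[v vS]] := eqVneq S set0.
  by rewrite card_darts big_set0.
rewrite (card_dartsD1 vS) oddD odd_double addbF; apply: IHk.
by move: leSk; rewrite (cardsD1 v S) vS.
Qed.

Lemma card_darts_split X A : X \subset A ->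
  \sum_(v in X) degree A v = #|darts X X| + #|darts X (A :\: X)|.
Proof.
move=> XA; rewrite !card_darts -big_split; apply: eq_bigr => v _ /=.
rewrite /degree -(cardsID X [set u in A | G v u]); congr (_ + _); apply: eq_card => u.
  rewrite !inE; case: (boolP (u \in X)) => [/(subsetP XA) ->|_]; by rewrite ?andbT ?andbF.
by rewrite !inE andbA.
Qed.

(* X plays the part of the connected component of x in S, of which only these
   properties are needed. *)
Lemma grow_tree (x : V) (S : {set V}) : x \in S ->
  exists X, [/\ x \in X, X \subset S, #|X|.*2 <= #|darts X X| + 2 &
    forall a b, a \in X -> b \notin X -> G a b -> b \notin S].
Proof.
move=> xS.
pose P X := [&& x \in X, X \subset S & #|X|.*2 <= #|darts X X| + 2].
have P1 : P [set x] by rewrite /P set11 sub1set xS cards1 leq_addl.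
case: (arg_maxnP (fun X => #|X|) P1) => X /and3P[xX XS tree] max.
exists X; split=> // a b aX bX Gab; apply/negP => bS.
have : P (b |: X).
  apply/and3P; split; first by rewrite inE xX orbT.
    by rewrite subUset sub1set bS.
  rewrite (@card_dartsD1 _ b) ?setU11 // setU1K // cardsU1 bX.
  have : 0 < degree (b |: X) b.
    by apply/card_gt0P; exists a; rewrite !inE aX orbT adj_sym.
  lia.
by move/max; rewrite cardsU1 bX; lia.
Qed.

(* X, playing the component of x in S :&: T, has at most two edges leaving it, but
   if S <> T there are three: x y, one into S :\: T and one into T :\: S. *)
Lemma connected_set_determined A S T x y :
    (forall v, v \in A -> degree A v = 2) ->
    S \subset A -> T \subset A -> connected_set S -> connected_set T ->
    #|S| = #|T| -> x \in S -> x \in T -> y \in A -> y \notin S -> y \notin T ->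
  G x y -> S = T.
Proof.
move=> reg SA TA [_ cS] [_ cT] eqST xS xT yA yS yT Gxy.
have [|X [xX]] := @grow_tree x (S :&: T); first by rewrite inE xS.
rewrite subsetI => /andP[XS XT] tree max.
have X0 : X != set0 by apply/set0Pn; exists x.
have [eXS|neXS] := eqVneq X S.
  by apply/eqP; rewrite eqEcard -{1}eXS XT eqST /=.
have [eXT|neXT] := eqVneq X T.
  by apply/eqP; rewrite eq_sym eqEcard -{1}eXT XS eqST /=.
have [a [s [aX + Gas]]] := cS X ltac:(by rewrite properEneq neXS) X0.
have [b [t [bX + Gbt]]] := cT X ltac:(by rewrite properEneq neXT) X0.
rewrite !inE => /andP[tX tT] /andP[sX sS].
have := max _ _ aX sX Gas; rewrite inE sS /= => sT.
have := max _ _ bX tX Gbt; rewrite inE tT andbT => tS.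
have XA : X \subset A := subset_trans XS SA.
have sA := subsetP SA _ sS; have tA := subsetP TA _ tT.
have sub : [set (x, y); (a, s); (b, t)] \subset darts X (A :\: X).
  have yX : y \notin X by apply: contra yS; exact: (subsetP XS).
  by rewrite !subUset !sub1set !inE /= xX aX bX yX sX tX yA sA tA Gxy Gas Gbt.
have three : 3 <= #|darts X (A :\: X)|.
  apply: leq_trans (subset_leq_card sub).
  rewrite setUC cardsU1 cards2 !inE !xpair_eqE.
  have -> : (t == y) = false by apply/negbTE; apply: contraNneq yT => <-.
  have -> : (t == s) = false by apply/negbTE; apply: contraNneq tS => ->.
  have -> : (y == s) = false by apply/negbTE; apply: contraNneq yS => ->.
  by rewrite !andbF.
have := card_darts_split XA.
rewrite (eq_bigr (fun=> 2)); last by move=> v /(subsetP XA) /reg.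
by rewrite sum_nat_const => e; exfalso; clear -tree e three; lia.
Qed.

(* The number of edges leaving S is positive, and even as the degrees are. *)
Lemma boundary_ge2 A S :
    (forall v, v \in A -> degree A v = 2) -> connected_set A ->
    S \proper A -> S != set0 -> 2 <= #|darts S (A :\: S)|.
Proof.
move=> reg [_ cA] SA S0; have := card_darts_split (proper_sub SA).
rewrite (eq_bigr (fun=> 2)); last first.
  by move=> v /(subsetP (proper_sub SA)) /reg.
have := odd_card_darts S.
have [x [y [xS yS Gxy]]] := cA _ SA S0.
have : 0 < #|darts S (A :\: S)|.
  by apply/card_gt0P; exists (x, y); rewrite inE xS yS.
rewrite sum_nat_const; lia.
Qed.

Lemma card_connected_cycle A i (F : {set {set V}}) :
    (forall v, v \in A -> degree A v = 2) -> connected_set A ->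
    (forall S, S \in F -> [/\ S \subset A, #|S| = i & connected_set S]) ->
    i < #|A| -> #|F| <= #|A|.
Proof.
move=> reg cA HF iA.
(* Count the pairs (S, edge leaving S): by connected_set_determined each of the
   2 #|A| darts occurs at most once. *)
have low : #|F|.*2 <= \sum_(S in F) #|darts S (A :\: S)|.
  rewrite -muln2 -sum_nat_const; apply: leq_sum => S /HF[SA Si [S0 _]].
  by apply: boundary_ge2 => //; rewrite properEcard SA Si.
have up : \sum_(S in F) #|darts S (A :\: S)| <= #|darts A A|.
  have -> : \sum_(S in F) #|darts S (A :\: S)| =
      \sum_(S in F) \sum_(d in darts A A) (d \in darts S (A :\: S)).
    apply: eq_bigr => S /HF[SA _ _].
    rewrite -sum1_card big_mkcond [RHS]big_mkcond; apply: eq_bigr => d _ /=.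
    rewrite !inE; case dS: (d.1 \in S); rewrite ?if_same //=.
    by rewrite (subsetP SA _ dS) /=; case: (d.2 \in S); case: (d.2 \in A); case: (G d.1 d.2).
  rewrite exchange_big -sum1_card /=; apply: leq_sum => -[x y] _.
  have [S /andP[SF dS]|none] := pickP [pred S in F | (x, y) \in darts S (A :\: S)].
    rewrite (bigD1 S) //= big1 ?addn0 ?leq_b1 // => T /andP[TF neTS].
    case dT: (_ \in _) => //; case/eqP: neTS.
    have [[SA Si cS] [TA Ti cT]] := (HF _ SF, HF _ TF).
    move: dS dT; rewrite !inE /= => /and3P[xS /andP[yS yA] Gxy] /and3P[xT /andP[yT _] _].
    by apply: (connected_set_determined reg TA SA cT cS _ xT xS yA yT yS Gxy); rewrite Si.
  by rewrite big1 // => S SF; move: (none S); rewrite /= SF /= => ->.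
have tot : #|darts A A| = #|A|.*2.
  by rewrite card_darts (eq_bigr _ reg) sum_nat_const muln2.
by rewrite -leq_double -tot (leq_trans low).
Qed.

(** * Cop-win induced subgraphs: connectedness and cycles *)

(** If no edge joined [X] to the rest of [S], the cop would be confined to one side while the robber
    waits on the other. *)
Lemma cop_win_connected S : cop_win (induced G S) -> connected_set S.
Proof.
move=> win; have S0 : S != set0.
  by case: win => sigma _; apply/set0Pn; exists (val (sigma [::])); exact: valP.
split=> // X XS X0; apply: contrapT => noedge.
have sep x y : x \in X -> y \in S -> G x y -> y \in X.
  by move=> xX yS Gxy; apply/negPn/negP => yX; apply: noedge; exists x, y; rewrite inE yX.
apply: (@evasion_not_cop_win _ _ (fun c r => (val c \in X) != (val r \in X))) win.
- move=> c; have [/set0Pn[x xX] [_ [y yS yX]]] := (X0, properP XS).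
  case: (boolP (val c \in X)) => _; first by exists (Sub y yS); rewrite /= (negbTE yX).
  by exists (Sub x (subsetP (proper_sub XS) _ xX)); rewrite /= xX.
- by move=> c r; apply: contraNneq => ->.
- move=> c r c' safe mv.
  have e : (val c' \in X) = (val c \in X).
    case/predU1P: mv => [->//|/= Gcc']; apply/idP/idP.
      by move=> c'X; apply: (sep _ _ c'X (valP c)); rewrite adj_sym.
    by move=> cX; apply: (sep _ _ cX (valP c')).
  rewrite -e in safe; split; first by apply: contraNneq safe => ->.
  by exists r => //; rewrite /move eqxx.
Qed.

Lemma degree2_three_neighbours A v a b c : degree A v = 2 ->
    a \in A -> b \in A -> c \in A -> G v a -> G v b -> G v c ->
  [|| a == b, a == c | b == c].
Proof.
move=> dv aA bA cA va vb vc; apply: contra_eqT dv; rewrite !negb_or => /and3P[ab ac bc].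
suff: 3 <= degree A v by lia.
have <- : #|[set a; b; c]| = 3
  by rewrite setUC cardsU1 cards2 ab !inE ![c == _]eq_sym negb_or ac bc.
by apply: subset_leq_card; rewrite !subUset !sub1set !inE aA bA cA va vb.
Qed.

(** The robber stays outside the closed neighbourhood of the cop. This fails only if the cop's
    vertex dominates the robber's closed neighbourhood, which puts both in a triangle. As all
    degrees are 2, no edge leaves this triangle, against connectedness of four or more vertices. *)
Lemma cycle_not_cop_win A :
    (forall v, v \in A -> degree A v = 2) -> connected_set A -> 4 <= #|A| ->
  ~ cop_win (induced G A).
Proof.
move=> reg [_ cA] A4.
apply: (@evasion_not_cop_win _ _ (fun c r => ~~ move (induced G A) c r)).
- move=> c; apply/not_existsP => all.
  have sub : A \subset val c |: [set u in A | G (val c) u].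
    apply/subsetP => x xA; have := all (Sub x xA); rewrite /move /= => /negP/negPn.
    by rewrite !inE xA -val_eqE eq_sym.
  have := subset_leq_card sub; rewrite cardsU1.
  by have := reg _ (valP c); rewrite /degree => ->; case: (_ \notin _); lia.
- by move=> c r; apply: contraNneq => ->; rewrite /move eqxx.
- move=> c r c' safe mv.
  have ne : c' != r by apply: contraNneq safe => <-.
  split=> //; apply: contrapT => none.
  (* With no safe reply, all that [r] can reach is within reach of [c']. *)
  have corner x : x \in A -> x = val r \/ G (val r) x -> x = val c' \/ G (val c') x.
    move=> xA xr; apply: contrapT => xc; apply: none; exists (exist _ x xA).
      by apply/orP; case: xr => [e|g]; [left; apply/eqP/val_inj | right].
    by apply/negP => /orP[/eqP e|g]; apply: xc; [left; rewrite e | right].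
  have Gcr : G (val c') (val r).
    by case: (corner _ (valP r) (or_introl erefl)) => // /eqP; rewrite val_eqE eq_sym (negbTE ne).
  have [w [wc wA Grw]] : exists w, [/\ w != val c', w \in A & G (val r) w].
    apply: contrapT => nw.
    suff : degree A (val r) <= 1 by rewrite (reg _ (valP r)).
    rewrite -(cards1 (val c')); apply: subset_leq_card; apply/subsetP => w.
    rewrite !inE => /andP[wA Grw]; apply/negPn/negP => wc; apply: nw; by exists w.
  have [e|Gcw] := corner w wA (or_intror Grw); first by rewrite e eqxx in wc.
  have rw : val r != w by apply: contraTneq Grw => <-; rewrite adj_irrefl.
  have c'A : val c' \in A := valP c'; have rA : val r \in A := valP r.
  have XA : [set val c'; val r; w] \proper A.
    rewrite properEcard !subUset !sub1set c'A rA wA /=.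
    by rewrite (leq_trans _ A4) // ltnS setUC cardsU1 cards2 addnS;
      exact: leq_add (leq_b1 _) (leq_b1 _).
  have [|x [y [+ + Gxy]]] := cA _ XA; first by apply/set0Pn; exists w; rewrite !inE eqxx orbT.
  rewrite !inE !negb_or => + /andP[/andP[/andP[yc yr] yw] yA].
  case/orP=> [/orP[]|] /eqP e; subst x.
  + by have := degree2_three_neighbours (reg _ c'A) yA rA wA Gxy Gcr Gcw;
      rewrite (negbTE yr) (negbTE yw) (negbTE rw).
  + rewrite adj_sym in Gcr.
    by have := degree2_three_neighbours (reg _ rA) yA c'A wA Gxy Gcr Grw;
      rewrite (negbTE yc) (negbTE yw) eq_sym (negbTE wc).
  + rewrite adj_sym in Gcw; rewrite adj_sym in Grw.
    by have := degree2_three_neighbours (reg _ wA) yA c'A rA Gxy Gcw Grw;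
      rewrite (negbTE yc) (negbTE yr) eq_sym val_eqE eq_sym (negbTE ne).
Qed.

(** * Leaves of connected sets *)

Lemma connected_degree_gt0 A v :
  connected_set A -> v \in A -> 2 <= #|A| -> 0 < degree A v.
Proof.
move=> [_ cA] vA A2.
have [||x [y [+ + Gxy]]] := cA [set v].
- by rewrite properEcard sub1set vA cards1.
- by apply/set0Pn; exists v; rewrite set11.
rewrite !inE => /eqP e /andP[_ yA]; subst x.
by apply/card_gt0P; exists y; rewrite inE yA.
Qed.

(** An edge leaving [X] comes from the connectedness of [A], applied to [v |: X] if [u] is in [X]
    and to [X] otherwise. In neither case can it meet [v], whose only neighbour is [u]. *)
Lemma connected_setD1_leaf A v u :
    connected_set A -> v \in A -> u \in A -> degree A v = 1 -> G v u ->
  connected_set (A :\ v).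
Proof.
move=> [_ cA] vA uA dv Gvu.
have uniq w : w \in A -> G v w -> w = u.
  move=> wA Gvw; have /eqP/cards1P[z ez] := dv.
  have : w \in [set z] by rewrite -ez inE wA.
  have : u \in [set z] by rewrite -ez inE uA.
  by rewrite !inE => /eqP-> /eqP->.
have uv : u != v by apply: contraTneq Gvu => ->; rewrite adj_irrefl.
split; first by apply/set0Pn; exists u; rewrite !inE uv.
move=> X /properP[XA [z]]; rewrite !inE => /andP[zv zA] zX X0.
have [uX|uX] := boolP (u \in X).
- have pX : v |: X \proper A.
    apply/properP; split; last by exists z; rewrite // !inE negb_or zv.
    by rewrite subUset sub1set vA (subset_trans XA) ?subsetDl.
  have [|x [y [+ + Gxy]]] := cA _ pX; first by apply/set0Pn; exists v; rewrite setU11.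
  rewrite !inE negb_or => + /andP[/andP[yv yX] yA].
  case/predU1P => [e|xX]; last by exists x, y; rewrite !inE yX yv.
  by subst x; rewrite (uniq _ yA Gxy) uX in yX.
- have pX : X \proper A.
    apply/properP; split; last by exists z.
    by rewrite (subset_trans XA) ?subsetDl.
  have [x [y [xX + Gxy]]] := cA _ pX X0.
  rewrite !inE => /andP[yX yA]; exists x, y; split => //; rewrite !inE yX yA andbT /=.
  apply: contraNneq uX => e; subst y.
  have /(subsetP XA) := xX; rewrite !inE => /andP[_ xA].
  by rewrite -(uniq _ xA) // adj_sym.
Qed.

(** * Counting cop-win sets of a given size *)

Lemma card_supersets A B i : B \subset A ->
  #|[set S : {set V} | [&& B \subset S, S \subset A & #|S| == #|B| + i]]| =
    'C(#|A| - #|B|, i).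
Proof.
move=> BA; rewrite -(setIidPr BA) -cardsD -cards_draws (setIidPr BA).
rewrite -(@card_in_imset _ _ (fun T => B :|: T)
  (mem [set T : {set V} | T \subset A :\: B & #|T| == i])).
  apply: eq_card => S; apply/idP/imsetP => [|[T]].
    rewrite inE => /and3P[BS SA /eqP Si]; exists (S :\: B).
      by rewrite inE setSD //= cardsD (setIidPr BS) Si addKn.
    by rewrite setDE setUIr setUCr setIT (setUidPr BS).
  rewrite !inE => /andP[TA /eqP Ti] ->; rewrite subsetUl subUset BA /=.
  rewrite (subset_trans TA) ?subsetDl //= cardsU disjoint_setI0 ?cards0 ?subn0 ?Ti //.
  by move: TA; rewrite subsetD disjoint_sym => /andP[].
move=> T1 T2; rewrite !inE !subsetD => /andP[/andP[_ d1] _] /andP[/andP[_ d2] _]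
  /(congr1 (fun S => S :\: B)).
by rewrite !setDUl setDv !set0U !(setDidPl _).
Qed.

Lemma cop_sets_le A i : #|cop_sets A i| <= 'C(#|A|, i).
Proof.
rewrite -cards_draws; apply: subset_leq_card; apply/subsetP => S.
by rewrite !inE => /and3P[-> ->].
Qed.

Lemma cop_setsP A i S :
  reflect [/\ S \subset A, #|S| = i & cop_win (induced G S)] (S \in cop_sets A i).
Proof.
rewrite inE; apply: (iffP and3P) => -[SA Si win]; split=> //; try exact/eqP.
  exact/asboolP.
exact/asboolP.
Qed.

Lemma cop_sets_cycle_le A i :
  (forall v, v \in A -> degree A v = 2) -> connected_set A -> i < #|A| ->
  #|cop_sets A i| <= #|A|.
Proof.
move=> reg cA iA; apply: (card_connected_cycle reg cA _ iA) => S /cop_setsP[SA Si win].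
by split=> //; exact: cop_win_connected.
Qed.

Lemma cop_sets_cycle_eq0 A i :
  (forall v, v \in A -> degree A v = 2) -> connected_set A -> 4 <= #|A| ->
  #|A| <= i -> #|cop_sets A i| = 0.
Proof.
move=> reg cA A4 Ai; apply/eqP; rewrite cards_eq0; apply/set0Pn => -[S /cop_setsP[SA Si win]].
have e : S = A by apply/eqP; rewrite eqEcard SA Si.
by subst S; exact: cycle_not_cop_win win.
Qed.

(** By Pascal's rule the binomial gains at least one with each step of [m], starting from
    ['C(4, 2) = 6]. For a cycle of length [m + 1] this beats the bound on its connected sets of a
    given size. *)
Lemma bin_gt m i : 4 <= m -> 2 <= i -> i <= m - 2 -> m.+1 < 'C(m, i).
Proof.
elim: m i => // m IHm [//|i] m4 i2 im; rewrite binS.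
have [m4'|m3] : 4 <= m \/ m = 3 by lia.
  have [im'|e] : i.+1 <= m - 2 \/ i = m - 2 by lia.
    have := IHm _ m4' i2 im'; have : 0 < 'C(m, i) by rewrite bin_gt0; lia.
    by lia.
  have : m.+1 < 'C(m, i) by apply: IHm; lia.
  have : 0 < 'C(m, i.+1) by rewrite bin_gt0; lia.
  by lia.
by subst m; have -> : i = 1 by lia.
Qed.

Lemma cop_sets_leaf A v u i :
    v \in A -> u \in A -> degree A v = 1 -> G v u -> 2 <= i ->
  cop_sets A i \subset cop_sets (A :\ v) i :|:
    [set S : {set V} | [&& [set v; u] \subset S, S \subset A & #|S| == #|[set v; u]| + (i - 2)]].
Proof.
move=> vA uA dv Gvu i2; apply/subsetP => S /cop_setsP[SA Si win].
have vu : v != u by apply: contraTneq Gvu => ->; rewrite adj_irrefl.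
rewrite inE; have [vS|vS] := boolP (v \in S); last first.
  by apply/orP; left; apply/cop_setsP; rewrite subsetD1 SA vS.
apply/orP; right; rewrite inE SA cards2 vu Si subnKC // eqxx !andbT.
rewrite subUset !sub1set vS /=.
have /card_gt0P[w] : 0 < degree S v.
  by apply: connected_degree_gt0 => //; [exact: cop_win_connected | rewrite Si].
rewrite inE => /andP[wS Gvw].
suff -> : u = w by [].
have /eqP/cards1P[z ez] := dv.
have : w \in [set z] by rewrite -ez inE (subsetP SA) ?wS.
have : u \in [set z] by rewrite -ez inE uA.
by rewrite !inE => /eqP-> /eqP->.
Qed.

Lemma bin_le_pred m i : m <= i -> 0 < i -> 'C(m, i) <= 'C(m.-1, i.-1).
Proof.
by case: m i => [|m] [|i] // mi _; rewrite binS bin_small ?add0n //.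
Qed.

(** Pascal's rule splits the bound between the sets inside the cycle and those containing [v] and
    [u]. Only at [i = #|A :\ v|.-1] can the cycle exceed its share, and there [S0] makes up for
    it. *)
Lemma cop_sets_cycle_leaf A v u i :
    v \in A -> u \in A -> degree A v = 1 -> G v u -> connected_set (A :\ v) ->
    (forall w, w \in A :\ v -> degree (A :\ v) w = 2) -> 4 <= #|A :\ v| -> 3 <= i ->
  #|cop_sets A i| <= 'C(#|A|.-1, i.-1).
Proof.
move=> vA uA dv Gvu cA reg A4 i3.
have vu : v != u by apply: contraTneq Gvu => ->; rewrite adj_irrefl.
have Av : #|A| = #|A :\ v|.+1 by rewrite (cardsD1 v) vA.
have sub := @cop_sets_leaf A v u i vA uA dv Gvu ltac:(by lia).
have c2 : #|[set v; u]| = 2 by rewrite cards2 vu.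
have pA : [set v; u] \subset A by rewrite subUset !sub1set vA uA.
have cP := card_supersets (i - 2) pA.
set P := [set S | _] in sub cP.
have binE : 'C(#|A|.-1, i.-1) = 'C(#|A :\ v|.-1, i.-1) + 'C(#|A :\ v|.-1, i - 2).
  have -> : i.-1 = (i - 2).+1 by lia.
  by rewrite Av /=; case: (#|A :\ v|) A4 => // k _; rewrite binS.
have cP' : #|P| = 'C(#|A :\ v|.-1, i - 2) by rewrite cP c2 Av; congr 'C(_, _); lia.
have le1 : #|cop_sets A i| <= #|cop_sets (A :\ v) i| + #|P|.
  by apply: leq_trans (subset_leq_card sub) _; rewrite cardsU leq_subr.
have [ge|lt] := leqP #|A :\ v| i.
  by rewrite (cop_sets_cycle_eq0 reg cA A4 ge) cP' in le1; rewrite binE; lia.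
have leA := cop_sets_cycle_le reg cA lt.
have [i_le|i_eq] : i <= #|A :\ v| - 2 \/ i = #|A :\ v|.-1 by lia.
  (* Length 4 leaves no such [i]; longer cycles satisfy the hypothesis [4 <= m] of [bin_gt]. *)
  have [e3|] := leqP #|A :\ v| 4; first by lia.
  move=> A5; have := @bin_gt #|A :\ v|.-1 i.-1 ltac:(by lia) ltac:(by lia) ltac:(by lia).
  by rewrite cP' in le1; rewrite binE; lia.
have uA' : u \in A :\ v by rewrite !inE eq_sym vu.
pose N := [set w in A :\ v | G u w].
have cN : #|N| = 2 := reg _ uA'.
(* Omitting both cycle neighbours of [u] cuts [v] and [u] off from the rest of [S0], which is
   nonempty as [3 <= i]. *)
pose S0 := A :\: N.
have NA : N \subset A by apply/subsetP => w; rewrite !inE => /andP[/andP[]].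
have cS0 : #|S0| = i by rewrite cardsD (setIidPr NA) cN Av; lia.
have pS0 : [set v; u] \subset S0.
  by rewrite subUset !sub1set !inE vA uA eqxx adj_irrefl /= andbF.
have S0P : S0 \in P by rewrite inE pS0 subsetDl cS0 c2 subnKC ?eqxx // ltnW.
have S0n : S0 \notin cop_sets A i.
  apply/cop_setsP => -[_ _ /cop_win_connected[_ cS]].
  have [||x [y [+ + Gxy]]] := cS [set v; u].
  - by rewrite properEcard pS0 c2 cS0.
  - by apply/set0Pn; exists v; rewrite set21.
  rewrite !inE negb_or => + /andP[/andP[yv yu] /andP[yN yA]].
  case/orP=> /eqP e; subst x; last by rewrite yv yA Gxy in yN.
  have /eqP/cards1P[z ez] := dv.
  have : y \in [set z] by rewrite -ez inE yA.
  have : u \in [set z] by rewrite -ez inE uA.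
  by rewrite !inE => /eqP uz /eqP yz; rewrite uz yz eqxx in yu.
have sub' : cop_sets A i \subset cop_sets (A :\ v) i :|: (P :\ S0).
  apply/subsetP => S SC; have := subsetP sub _ SC; rewrite !in_setU.
  case/orP=> [->//|SP]; rewrite in_setD1 SP andbT; apply/orP; right.
  by apply: contraNneq S0n => <-.
apply: leq_trans (subset_leq_card sub') _; apply: leq_trans (leq_card_setU _ _) _.
(* With [k = #|A :\ v|], the cycle's share ['C(k - 1, k - 2)] is [k - 1], one too few; removing [S0]
   from [P] supplies the one. *)
have -> : 'C(#|A|.-1, i.-1) = #|A :\ v| + #|P :\ S0|; last exact: leq_add.
rewrite binE -cP' (cardsD1 S0 P) S0P addnA addn1 i_eq; congr addn.
by case: (#|A :\ v|) A4 => [|[|k]] // _; rewrite binSn.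
Qed.

(** Connected 2-regular sets are cycles; length 3 is left out because a triangle obeys the binomial
    bound. *)
Definition is_cycle A :=
  [/\ connected_set A, forall v, v \in A -> degree A v = 2 & 4 <= #|A|].

(** Leaves are stripped by induction: each deletion lowers [#|darts A A|] by 2 and [#|A|] by 1, so
    the dart hypothesis survives. *)
Lemma cop_sets_le_or_cycle A : connected_set A -> #|darts A A| <= #|A|.*2 ->
  (forall i, 3 <= i -> #|cop_sets A i| <= 'C(#|A|.-1, i.-1)) \/ is_cycle A.
Proof.
have [k] := ubnP #|A|; elim: k A => // k IHk A; rewrite ltnS => leAk cA dA.
have [A3|A4] := leqP #|A| 3.
  left=> i i3; apply: leq_trans (cop_sets_le A i) _.
  by apply: bin_le_pred; [exact: leq_trans A3 i3 | exact: ltnW (ltnW i3)].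
have [v /andP[vA /eqP dv]|noleaf] := pickP [pred v in A | degree A v == 1].
  have /card_gt0P[u] : 0 < degree A v by rewrite dv.
  rewrite inE => /andP[uA Gvu].
  have cA' := connected_setD1_leaf cA vA uA dv Gvu.
  have eA : #|A| = #|A :\ v|.+1 by rewrite (cardsD1 v) vA.
  have dA' : #|darts (A :\ v) (A :\ v)| <= #|A :\ v|.*2.
    by move: dA; rewrite (card_dartsD1 vA) dv eA doubleS addn2.
  left=> i i3; case: (IHk (A :\ v) ltac:(by rewrite -ltnS -eA) cA' dA') => [le|[_ reg A'4]].
    have sub := @cop_sets_leaf A v u i vA uA dv Gvu (ltnW i3).
    apply: leq_trans (subset_leq_card sub) _; apply: leq_trans (leq_card_setU _ _) _.
    have vu : v != u by apply: contraTneq Gvu => ->; rewrite adj_irrefl.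
    rewrite card_supersets ?subUset ?sub1set ?vA // cards2 vu eA subn2 /=.
    apply: leq_trans (leq_add (le i i3) (leqnn _)) _.
    have -> : i.-1 = (i - 2).+1 by case: i i3 {sub} => [|[|i]] // _; rewrite subn2.
    by rewrite eA in A4; case: (#|A :\ v|) A4 => // j _; rewrite !subSS subn0 binS.
  exact: (cop_sets_cycle_leaf vA uA dv Gvu cA' reg A'4 i3).
right; split=> //.
have ge2 v : v \in A -> 2 <= degree A v.
  move=> vA; have := connected_degree_gt0 cA vA (ltnW (ltnW A4)).
  by have /= := noleaf v; rewrite vA /=; case: (degree A v) => [|[|]].
(* With all degrees at least 2, a single larger one would push the dart count above [#|A|.*2]. *)
move=> v vA; apply/eqP; rewrite eqn_leq ge2 // andbT leqNgt; apply/negP => gt2.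
move: dA; rewrite card_darts (big_setD1 v) //= leqNgt => /negP[].
have : \sum_(w in A :\ v) 2 <= \sum_(w in A :\ v) degree A w.
  by apply: leq_sum => w; rewrite inE => /andP[_]; exact: ge2.
rewrite sum_nat_const muln2 (cardsD1 v A) vA doubleD => le.
by apply: leq_trans (leq_add gt2 le); rewrite addSn.
Qed.

(** * Coefficients of a unicyclic graph *)

Lemma W_cop_sets i : W G i = #|cop_sets setT i|.
Proof. by apply: eq_card => S; rewrite !inE subsetT. Qed.

Lemma dominating_set_cop_win S d :
  d \in S -> (forall x, x \in S -> move G d x) -> cop_win (induced G S).
Proof.
move=> dS dom; apply: (@dominating_cop_win _ _ (exist _ d dS)) => -[x xS].
by rewrite /move -val_eqE /=; exact: dom.
Qed.

Lemma W1 : W G 1 = #|V|.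
Proof.
rewrite W_cop_sets -cardsT -(card_imset _ (@set1_inj V)); apply: eq_card => S.
apply/cop_setsP/imsetP => [[_ /eqP/cards1P[x ->] _]|[x _ ->]]; first by exists x.
split; rewrite ?subsetT ?cards1 //; apply: (@dominating_set_cop_win _ x).
  exact: set11.
by move=> y /set1P ->; rewrite /move eqxx.
Qed.

(** A cop-win pair is connected, hence an edge. With [W1], all unicyclic graphs of one order agree
    at sizes 1 and 2. *)
Lemma W2 : W G 2 = #|edges G|.
Proof.
rewrite W_cop_sets; apply: eq_card => S; apply/cop_setsP/imsetP => [[_ S2 win]|[[x y]]].
  have /cards2P[x [y [xy eS]]] : #|S| == 2 by rewrite S2.
  exists (x, y); rewrite // inE /=.
  have xS : x \in S by rewrite eS set21.
  have /card_gt0P[z] := connected_degree_gt0 (cop_win_connected win) xS ltac:(by rewrite S2).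
  rewrite inE eS => /andP[/set2P[]->//]; by rewrite adj_irrefl.
rewrite inE /= => Gxy ->; have xy : x != y by apply: contraTneq Gxy => ->; rewrite adj_irrefl.
split; rewrite ?subsetT ?cards2 ?xy //; apply: (@dominating_set_cop_win _ x).
  exact: set21.
by move=> z /set2P[] ->; rewrite /move ?eqxx ?Gxy ?orbT.
Qed.

Lemma connected_setT : connected G -> connected_set setT.
Proof.
move=> [V0 conn]; split; first by rewrite -card_gt0 cardsT.
move=> X /properP[_ [y _ yX]] /set0Pn[x xX]; apply: contrapT => none.
have cl : closed G X.
  apply: intro_closed => [a b|a b Gab aX]; first by rewrite (sym_connect_sym (@adj_sym _ G)).
  by apply/negPn/negP => bX; apply: none; exists a, b; rewrite !inE bX.
by have := closed_connect cl (conn x y); rewrite xX (negbTE yX).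
Qed.

(** Double counting of incidences: for fixed [v], sending [u] to [[set v; u]] injects the neighbours
    of [v] into the edges at [v]. *)
Lemma card_darts_edges : #|darts setT setT| <= #|edges G|.*2.
Proof.
rewrite card_darts -muln2 -sum_nat_const.
have -> : \sum_(e in edges G) 2 = \sum_(v in setT) \sum_(e in edges G) (v \in e).
  rewrite exchange_big; apply: eq_bigr => e /imsetP[[x y]]; rewrite inE /= => Gxy ->.
  have xy : x != y by apply: contraTneq Gxy => ->; rewrite adj_irrefl.
  transitivity #|[set x; y]|; first by rewrite cards2 xy.
  rewrite -sum1_card big_mkcond [RHS]big_mkcond; apply: eq_bigr => v _.
  by rewrite in_setT; case: (v \in _).
apply: leq_sum => v _.
have inj : injective (fun u => [set v; u]).
  move=> u w /setP e; have := e u; rewrite !inE eqxx orbT; case/esym/predU1P=> [ev|/eqP//].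
  by have := e w; rewrite !inE eqxx orbT ev orbb => /eqP.
rewrite /degree -(card_imset _ inj) -sum1_card [leqRHS]big_mkcond [leqLHS]big_mkcond.
apply: leq_sum => e _; case: ifP => // /imsetP[u]; rewrite !inE => Gvu ->.
have -> : [set v; u] \in edges G by apply/imsetP; exists (v, u); rewrite ?inE.
by rewrite set21.
Qed.

(** The second alternative is the cycle; its strict inequality just below [#|V|.-1] later helps to
    pay for a possible excess of one at [#|V|.-1]. *)
Lemma unicyclic_W : unicyclic G ->
  (forall i, 3 <= i -> W G i <= 'C(#|V|.-1, i.-1)) \/
  [/\ forall i, 3 <= i -> i < #|V|.-1 -> W G i < 'C(#|V|.-1, i.-1),
      W G #|V|.-1 <= #|V| & W G #|V| = 0].
Proof.
move=> [conn eV]; have cT := connected_setT conn.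
have dT : #|darts setT setT| <= #|[set: V]|.*2 by rewrite cardsT eV card_darts_edges.
have [le|[_ reg T4]] := cop_sets_le_or_cycle cT dT.
  by left=> i i3; rewrite W_cop_sets -cardsT; exact: le.
have [conn0 _] := conn.
right; rewrite !W_cop_sets -!cardsT; split.
- move=> i i3 iV; rewrite W_cop_sets.
  apply: leq_ltn_trans (cop_sets_cycle_le reg cT _) _; first lia.
  suff : #|[set: V]|.-1.+1 < 'C(#|[set: V]|.-1, i.-1) by lia.
  by apply: bin_gt; lia.
- by apply: cop_sets_cycle_le => //; lia.
- exact: (cop_sets_cycle_eq0 reg cT T4).
Qed.

End Sets.

(** * Edges and cop-win sets of [U_graph] *)

Section UGraph.
Variable n : nat.

Lemma U_adj0 (v : 'I_n.+1) : U_graph n.+1 ord0 v = (v != ord0).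
Proof. by rewrite /= /U_adj /= eq_sym andbT. Qed.

(** Every set through the centre is dominated by it, hence cop-win. *)
Lemma W_U_ge i : 0 < i -> 'C(n, i.-1) <= W (U_graph n.+1) i.
Proof.
move=> i0; rewrite W_cop_sets.
have := card_supersets i.-1 (subsetT [set (ord0 : 'I_n.+1)]).
rewrite cardsT card_ord cards1 subn1 /= => <-; apply: subset_leq_card.
apply/subsetP => S; rewrite inE sub1set add1n prednK // => /and3P[S0 _ /eqP Si].
apply/cop_setsP; split; rewrite ?subsetT //.
apply: (dominating_set_cop_win S0) => x _.
by rewrite /move U_adj0 eq_sym orbN.
Qed.

Lemma edges_U : 3 <= n.+1 -> #|edges (U_graph n.+1)| = n.+1.
Proof.
move=> n3; pose a : 'I_n.+1 := inord 1; pose b : 'I_n.+1 := inord 2.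
have va : val a = 1 by rewrite /= inordK // ltnW.
have vb : val b = 2 by rewrite /= inordK.
(* A bijection from vertices to edges: the centre goes to the edge [ab], any other vertex to its
   edge with the centre. *)
pose f (x : 'I_n.+1) : {set 'I_n.+1} := if x == ord0 then [set a; b] else [set ord0; x].
have a0 : a != ord0 by rewrite -val_eqE va.
have b0 : b != ord0 by rewrite -val_eqE vb.
have inj : injective f.
  move=> x y; rewrite /f; have [->|x0] := eqVneq x ord0; have [->|y0] := eqVneq y ord0 => //.
  - by move/setP/(_ ord0); rewrite !inE eqxx eq_sym (negbTE a0) eq_sym (negbTE b0).
  - by move/setP/(_ ord0); rewrite !inE eqxx ![ord0 == _]eq_sym (negbTE a0) (negbTE b0).
  - by move/setP/(_ x); rewrite !inE eqxx orbT (negbTE x0) => /esym/eqP.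
rewrite -[RHS]card_ord -cardsT -(card_imset _ inj); apply: eq_card => e.
apply/imsetP/imsetP => [[[x y]]|[x _ ->]].
  rewrite inE /= => /andP[xy].
  have [x0|x0] := eqVneq x ord0.
    by move=> _ ->; exists y; rewrite // /f -x0 eq_sym (negbTE xy).
  have [->|y0] := eqVneq y ord0.
    by move=> _ ->; exists x; rewrite // /f (negbTE x0) setUC.
  have nz (z : 'I_n.+1) : z != ord0 -> (val z == 0) = false by move/negbTE; rewrite -val_eqE.
  rewrite !nz //= => /andP[]; rewrite !inE => hx hy ->; exists ord0; rewrite // /f eqxx.
  have [[ex|ex] [ey|ey]] : (x = a \/ x = b) /\ (y = a \/ y = b).
    split; [case/orP: hx | case/orP: hy] => /eqP h; [left|right|left|right];
      by apply: val_inj; rewrite ?va ?vb; exact: h.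
  - by rewrite ex ey eqxx in xy.
  - by rewrite ex ey.
  - by rewrite ex ey setUC.
  - by rewrite ex ey eqxx in xy.
rewrite /f; have [_|x0] := eqVneq x ord0.
  by exists (a, b); rewrite // inE /= /U_adj -val_eqE va vb.
by exists (ord0, x); rewrite // inE -[U_graph _ _ _]/(U_graph n.+1 ord0 x) U_adj0.
Qed.

Lemma U_unicyclic : 3 <= n.+1 -> unicyclic (U_graph n.+1).
Proof.
move=> n3; split; last by rewrite edges_U // card_ord.
have c0 v : connect (U_graph n.+1) ord0 v.
  have [->|v0] := eqVneq v ord0; first exact: connect0.
  by apply: connect1; rewrite U_adj0.
split; first by rewrite card_ord.
move=> u v; apply: connect_trans (c0 v).
by rewrite (sym_connect_sym (@adj_sym _ (U_graph n.+1))).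
Qed.

End UGraph.

(** * Comparison of the reliability polynomials *)

Local Open Scope ring_scope.

Theorem theorem3p5 (R : realType) (n : nat) (hn : (5 <= n)%N) :
  unicyclic (U_graph n) /\
  forall (V : finType) (G : sgraph V), #|V| = n -> unicyclic G ->
  forall p : R, 0 <= p <= 1 -> NCRel G p <= NCRel (U_graph n) p.
Proof.
case: n hn => // n hn; have n3 : (3 <= n.+1)%N by apply: leq_trans hn.
have uU := U_unicyclic n3; split=> // V G cV uG p /andP[p0 p1].
have q0 : 0 <= 1 - p by rewrite subr_ge0.
have term_le (x y i : nat) : (x <= y)%N ->
    x%:R * (1 - p) ^+ (n.+1 - i) * p ^+ i <= y%:R * (1 - p) ^+ (n.+1 - i) * p ^+ i.
  by move=> xy; rewrite ler_wpM2r ?exprn_ge0 // ler_wpM2r ?exprn_ge0 // ler_nat.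
have small i : (0 < i < 3)%N -> W G i = W (U_graph n.+1) i.
  case: uG uU => [_ eG] [_ eU]; case: i => [|[|[|i]]] // _.
    by rewrite !W1 card_ord.
  by rewrite !W2 -eG -eU card_ord.
rewrite /NCRel card_ord cV.
have [le|[lt le_n1 eq_n]] := unicyclic_W uG.
  apply: ler_sum_nat => i /andP[i0 _]; apply: term_le.
  have [i3|i3] := ltnP i 3; first by rewrite small ?i0.
  by apply: leq_trans (W_U_ge _ i0); rewrite -[n in 'C(n, _)]/(n.+1.-1) -cV le.
rewrite cV /= in lt le_n1 eq_n.
case: n hn n3 uU cV term_le small lt le_n1 eq_n => [|[|m]] //
  hn _ uU cV term_le small lt le_n1 eq_n.
(* For the cycle the top three sizes are weighed together; below them the comparison is term by
   term. *)
have last3 (F : nat -> R) : \sum_(1 <= i < m.+4) F i =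
    \sum_(1 <= i < m.+1) F i + (F m.+1 + (F m.+2 + F m.+3)).
  by rewrite big_nat_recr //= big_nat_recr //= big_nat_recr //= !addrA.
rewrite !last3; apply: lerD.
  apply: ler_sum_nat => i /andP[i0 im]; apply: term_le.
  have [i3|i3] := ltnP i 3; first by rewrite small ?i0.
  apply: leq_trans (W_U_ge _ i0); apply: ltnW; apply: lt => //; lia.
(* Order at least 5 makes the size [m.+1] at least 3, so the strict bound applies. *)
have l1 : (W G m.+1).+1%:R <= (W (U_graph m.+3) m.+1)%:R :> R.
  by rewrite ler_nat; apply: leq_trans (W_U_ge _ _) => //; apply: lt; lia.
(* Here the cycle may win by one: up to [m.+3] sets against ['C(m.+2, m.+1) = m.+2]. *)
have l2 : (W G m.+2)%:R <= (W (U_graph m.+3) m.+2)%:R + 1 :> R.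
  rewrite natr1 ler_nat; apply: leq_trans le_n1 _; rewrite ltnS.
  by apply: leq_trans (W_U_ge _ _) => //=; rewrite binSn.
have l3 : 1 <= (W (U_graph m.+3) m.+3)%:R :> R.
  by rewrite ler1n; apply: leq_trans (W_U_ge _ _) => //=; rewrite binn.
rewrite eq_n mul0r mul0r addr0.
have -> : (m.+3 - m.+1)%N = 2%N by lia.
have -> : (m.+3 - m.+2)%N = 1%N by lia.
rewrite -natr1 in l1; rewrite subnn expr0 mulr1 expr1.
have -> : p ^+ m.+2 = p ^+ m.+1 * p by rewrite exprSr.
have -> : p ^+ m.+3 = p ^+ m.+1 * p ^+ 2 by rewrite -exprD addn2.
set t := p ^+ m.+1; have t0 : 0 <= t by rewrite exprn_ge0.
set g1 := (W G m.+1)%:R in l1 *; set g2 := (W G m.+2)%:R in l2 *.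
set u1 := (W _ m.+1)%:R in l1 *; set u2 := (W _ m.+2)%:R in l2 *.
set u3 := (W _ _)%:R in l3 *.
rewrite -subr_ge0.
(* By [l1], [l2] and [l3] the first three coefficients are nonnegative; the units split off from
   them form a positive semidefinite quadratic form in [1 - p] and [p]. *)
have -> : u1 * (1 - p) ^+ 2 * t + (u2 * (1 - p) * (t * p) + u3 * (t * p ^+ 2)) -
    (g1 * (1 - p) ^+ 2 * t + g2 * (1 - p) * (t * p)) =
  t * ((u1 - g1 - 1) * (1 - p) ^+ 2 + (u2 + 1 - g2) * ((1 - p) * p) +
       (u3 - 1) * p ^+ 2 + ((1 - p) ^+ 2 - (1 - p) * p + p ^+ 2)) by ring.
have quad : 0 <= (1 - p) ^+ 2 - (1 - p) * p + p ^+ 2 by nra.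
apply: mulr_ge0 => //; apply: addr_ge0 => //.
by rewrite !addr_ge0 ?mulr_ge0 ?exprn_ge0 //; lra.
Qed.
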